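(* Let $\mathcal{H}$ be a real Hilbert space, let $I=\{1,2,\ldots,m\}$, and let $C_1,C_2,\ldots,C_m\subseteq\mathcal{H}$ be closed and convex sets with $\bigcap_{i\in I}C_i\neq\emptyset$. For $t=1,2,\ldots,M$ let the block $I_t=(i_1^t,i_2^t,\ldots,i_{\gamma(t)}^t)$ be an ordered finite nonempty subset of $I$ with $\gamma(t)$ elements, such that $I=I_1\cup I_2\cup\cdots\cup I_M$. For each $t$ let $w_\ell^t>0$, $\ell=1,2,\ldots,\gamma(t)$, with $\sum_{\ell=1}^{\gamma(t)}w_\ell^t=1$, and define $$Q_t:=\sum_{\ell=1}^{\gamma(t)-1}w_\ell^t\,T_{i_\ell^t,i_{\ell+1}^t}+w_{\gamma(t)}^t\,T_{i_{\gamma(t)}^t,i_1^t},$$ where $T_{i,j}$ denotes the 2-set-Douglas-Rachford operator $T_{C_i,C_j}$. For any $x^0\in\mathcal{H}$, consider the Block-Iterative Douglas-Rachford iteration $x^{k+1}=Q_{t(k)}(x^k)$ with $t(k)=(k \bmod M)+1$, and let $\{y^k\}_{k=0}^\infty$ be the sequence of iterates after full sweeps through all blocks, i.e. $y^k=x^{kM}$, equivalently $y^0=x^0$ and $y^{k+1}=Q_MQ_{M-1}\cdots Q_2Q_1(y^k)$. Then: (i) $\{y^k\}_{k=0}^\infty$ converges weakly to a point $y^*$ such that, for every $t=1,2,\ldots,M$ and every $\ell=1,2,\ldots,\gamma(t)$, $P_{C_{i_\ell^t}}(y^* )\in\bigcap_{j=1}^{\gamma(t)}C_{i_j^t}$.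 (ii) If, in addition, $\operatorname{int}\bigcap_{i\in I}C_i\neq\emptyset$, then $\{y^k\}_{k=0}^\infty$ converges strongly to a point $y^*\in\bigcap_{i=1}^mC_i$.
   Context: For a nonempty closed convex set $A\subseteq\mathcal{H}$, $P_A$ is the orthogonal (nearest point, metric) projection onto $A$ and $R_A:=2P_A-\mathrm{Id}$ is the reflection operator into $A$, where $\mathrm{Id}$ is the identity. For nonempty closed convex sets $A,B\subseteq\mathcal{H}$, the 2-set-Douglas-Rachford operator is $T_{A,B}:=\frac12(\mathrm{Id}+R_BR_A):\mathcal{H}\to\mathcal{H}$ (reflect first into $A$, then into $B$, then take the midpoint with the original point). Juxtaposition of operators denotes composition, the rightmost being applied first. If $\gamma(t)=1$, then $Q_t=T_{i_1^t,i_1^t}$. *)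

(* Defs.v *)
From HB Require Import structures.
From mathcomp Require Import all_boot all_order all_algebra.
From mathcomp Require Import all_classical all_reals.
From mathcomp Require Import topology normedtype sequences convex.
Set Implicit Arguments.
Unset Strict Implicit.
Unset Printing Implicit Defensive.
Import Order.TTheory GRing.Theory Num.Theory.
Import numFieldNormedType.Exports.
Local Open Scope classical_set_scope.
Local Open Scope ring_scope.

(* Real Hilbert spaces: complete normed spaces whose norm is induced by an
   inner product, i.e. a positive definite symmetric bilinear form. *)
HB.mixin Record isHilbert (R : realType) (H : Type)
    of CompleteNormedModule R H := {
  inner : {dot H for @idfun R} ;
  normE_inner : forall x : H, `|x| ^+ 2 = inner x x
}.

#[short(type="hilbertType")]
HB.structure Definition Hilbert (R : realType) :=
  {H of isHilbert R H & CompleteNormedModule R H}.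

Section hilbert.
Context {R : realType} {H : hilbertType R}.
Implicit Types (A B : set H) (x p : H) (y : nat -> H).

Definition weakly_cvg_to y (l : H) :=
  forall u : H, @inner R H (y n) u @[n --> \oo] --> @inner R H l u.

Definition is_nearest_point A x p :=
  A p /\ forall a, A a -> `|x - p| <= `|x - a|.

(* The metric projection. For A nonempty, closed and convex there is exactly
   one nearest point; when there is none, x itself is returned. *)
Definition metric_proj A x : H := xget x [set p | is_nearest_point A x p].

Definition reflector A x : H := 2 *: metric_proj A x - x.

Definition DR A B x : H := 2^-1 *: (x + reflector B (reflector A x)).

(* The block (i 0, ..., i (g - 1)), 0-based. The cyclic successor ordS sends
   the last index g - 1 back to 0, so that the last term of the sum is
   w (g - 1) *: DR (C (i (g - 1))) (C (i 0)) x. *)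
Definition block_DR (m : nat) (C : 'I_m -> set H) (g : nat)
    (i : 'I_g -> 'I_m) (w : 'I_g -> R) x : H :=
  \sum_(l < g) w l *: DR (C (i l)) (C (i (ordS l))) x.

End hilbert.

(* Main.v *)
(* Write [y n] for the iterates after full sweeps and [F] for the set of common
   fixed points of all operators [T] = [DR (C (i l)) (C (i (ordS l)))]. Each [T]
   is firmly nonexpansive, so the iteration is Fejer monotone with respect to
   [F], which contains the intersection of the [C i], and its residuals
   [y n - T (y n)] tend to 0. Along an ultrafilter [U] the bounded sequence [y]
   has a weak limit, namely the minimizer of [z |-> lim_U |y n - z|], and
   demiclosedness puts it in [F]; by Opial's argument it does not depend on [U],
   which gives weak convergence. At a point [c] of [F], projecting [c] onto
   [C (i l)] gives a point of [C (i (ordS l))]; since the blocks are cyclic, all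
   these projections coincide. When the intersection has an interior point,
   Fejer monotonicity makes the steps summable, and every point of [F] is its
   own projection. *)
Require Import Defs.
From HB Require Import structures.
From mathcomp Require Import all_boot all_order all_algebra.
From mathcomp Require Import all_classical all_reals.
From mathcomp Require Import topology normedtype sequences convex.
From mathcomp Require Import interval_inference ring lra.
Set Implicit Arguments.
Unset Strict Implicit.
Unset Printing Implicit Defensive.
Import Order.TTheory GRing.Theory Num.Theory.
Import numFieldNormedType.Exports.
Local Open Scope classical_set_scope.
Local Open Scope ring_scope.

(** * Inner product and norm identities *)

Section inner_product.
Context {R : realType} {H : hilbertType R}.
Implicit Types (a b c : H) (k : R).
Local Notation "<< a , b >>" := (@inner R H a b)
  (at level 0, format "<< a ,  b >>").

Lemma innerC a b : <<a, b>> = <<b, a>>.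
Proof. by rewrite hermitian_subproof /= mul1r. Qed.

Lemma innerDl a b c : <<a + b, c>> = <<a, c>> + <<b, c>>.
Proof. exact: linearDl. Qed.

Lemma innerNl a b : <<- a, b>> = - <<a, b>>.
Proof. exact: linearNl. Qed.

Lemma innerBl a b c : <<a - b, c>> = <<a, c>> - <<b, c>>.
Proof. by rewrite innerDl innerNl. Qed.

Lemma innerZl k a b : <<k *: a, b>> = k * <<a, b>>.
Proof. exact: linearZl_LR. Qed.

Lemma innerDr a b c : <<a, b + c>> = <<a, b>> + <<a, c>>.
Proof. by rewrite innerC innerDl !(innerC _ a). Qed.

Lemma innerNr a b : <<a, - b>> = - <<a, b>>.
Proof. by rewrite innerC innerNl innerC. Qed.

Lemma innerBr a b c : <<a, b - c>> = <<a, b>> - <<a, c>>.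
Proof. by rewrite innerDr innerNr. Qed.

Lemma innerZr k a b : <<a, k *: b>> = k * <<a, b>>.
Proof. by rewrite innerC innerZl innerC. Qed.

Definition innerE :=
  (innerBl, innerBr, innerDl, innerDr, innerNl, innerNr, innerZl, innerZr).

Lemma sqr_normD a b : `|a + b| ^+ 2 = `|a| ^+ 2 + 2 * <<a, b>> + `|b| ^+ 2.
Proof. by rewrite !normE_inner !innerE (innerC b a); ring. Qed.

Lemma sqr_normB a b : `|a - b| ^+ 2 = `|a| ^+ 2 - 2 * <<a, b>> + `|b| ^+ 2.
Proof. by rewrite sqr_normD innerNr normrN; ring. Qed.

Lemma sqr_normZ k a : `|k *: a| ^+ 2 = k ^+ 2 * `|a| ^+ 2.
Proof. by rewrite normrZ exprMn real_normK ?num_real. Qed.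

Lemma sqr_norm_midpoint a b c :
  `|c - 2^-1 *: (a + b)| ^+ 2 =
  2^-1 * `|c - a| ^+ 2 + 2^-1 * `|c - b| ^+ 2 - 4^-1 * `|a - b| ^+ 2.
Proof.
rewrite !normE_inner !innerE (innerC c a) (innerC c b) (innerC b a).
by field.
Qed.

Lemma ler_sqr_norm a b : (`|a| ^+ 2 <= `|b| ^+ 2) = (`|a| <= `|b|).
Proof. by rewrite ler_pXn2r ?nnegrE. Qed.

(** The weighted variance of the [u l] about their weighted mean is nonnegative. *)
Lemma sqr_norm_sum_le (g : nat) (w : 'I_g -> R) (u : 'I_g -> H) :
  (forall l, 0 < w l) -> \sum_(l < g) w l = 1 ->
  `|\sum_(l < g) w l *: u l| ^+ 2 <= \sum_(l < g) w l * `|u l| ^+ 2.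
Proof.
move=> w0 w1; set s := \sum_(l < g) w l *: u l.
have : 0 <= \sum_(l < g) w l * `|u l - s| ^+ 2.
  by apply: sumr_ge0 => l _; rewrite mulr_ge0 ?sqr_ge0 ?ltW.
have E l : w l * `|u l - s| ^+ 2 =
    w l * `|u l| ^+ 2 + (- 2) * <<w l *: u l, s>> + w l * `|s| ^+ 2.
  by rewrite sqr_normB innerZl; ring.
rewrite (eq_bigr _ (fun l _ => E l)) !big_split /= -mulr_sumr -mulr_suml w1.
have -> : \sum_(i < g) <<w i *: u i, s>> = <<s, s>>.
  rewrite {2}/s; elim/big_rec2: _ => [|i x y _ ->]; last by rewrite innerDl.
  by rewrite -(scale0r s) innerZl mul0r.
by rewrite -normE_inner; lra.
Qed.

End inner_product.

(** * Minimizers of distance-like functions *)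

Section minimizer.
Context {R : realType} {H : hilbertType R}.
Implicit Types (A : set H) (h : H -> R) (a b p x : H).
Local Notation "<< a , b >>" := (@inner R H a b)
  (at level 0, format "<< a ,  b >>").

Definition midpoint_convex A :=
  forall a b, A a -> A b -> A (2^-1 *: (a + b)).

(* A minimizing sequence is Cauchy by the parallelogram law. *)
Lemma exists_minimizer A h : closed A -> A !=set0 -> midpoint_convex A ->
  (forall a, 0 <= h a) -> (forall a b, h a <= h b + `|a - b|) ->
  (forall a b, h (2^-1 *: (a + b)) ^+ 2 =
     2^-1 * h a ^+ 2 + 2^-1 * h b ^+ 2 - 4^-1 * `|a - b| ^+ 2) ->
  exists2 p, A p & forall a, A a -> h p <= h a.
Proof.
move=> Acl [a0 Aa0] Amid h0 hlip hmid.
pose E := [set h a ^+ 2 | a in A].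
have Einf : has_inf E.
  split; first by exists (h a0 ^+ 2), a0.
  by exists 0 => _ [a _ <-]; exact: sqr_ge0.
have Dle a : A a -> inf E <= h a ^+ 2.
  by move=> Aa; apply: ge_inf; [case: Einf|exists a].
have /choice[u uP] (n : nat) :
    exists a, A a /\ h a ^+ 2 < inf E + n.+1%:R^-1.
  have n0 : (0 : R) < n.+1%:R^-1 by rewrite invr_gt0.
  by have [_ [a Aa <-] aP] := inf_adherent n0 Einf; exists a.
have uA n : A (u n) by case: (uP n).
have uD n : h (u n) ^+ 2 < inf E + n.+1%:R^-1 by case: (uP n).
have ucvg : cvg (u @ \oo).
  apply: cauchy_cvg; apply/cauchyP => e e0.
  have e8 : 0 < e ^+ 2 / 4 by rewrite divr_gt0 ?exprn_gt0.
  have [N _ NP] := near_infty_natSinv_lt (PosNum e8).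
  exists (u N); exists N => // n /= Nn.
  rewrite -ball_normE /=.
  rewrite -(@ltr_pXn2r _ 2) ?nnegrE ?(ltW e0) //.
  have : N.+1%:R^-1 < e ^+ 2 / 4 := NP _ (leqnn N).
  have : n.+1%:R^-1 < e ^+ 2 / 4 := NP _ Nn.
  (* The midpoint of [u N] and [u n] has squared value at least [inf E], so by [hmid] a quarter of
     their squared distance is at most the mean of the two errors. *)
  have := uD N; have := uD n; have := Dle _ (Amid _ _ (uA N) (uA n)).
  rewrite hmid; move: (inf E) (n.+1%:R^-1) (N.+1%:R^-1) => D r s; lra.
set p := lim (u @ \oo) in ucvg.
have Ap : A p.
  by apply: (closed_cvg A Acl _ p ucvg); apply: nearW.
exists p => // a Aa; rewrite leNgt; apply/negP => hap.
(* Half the gap: close to [p] the value [h (u n)] exceeds [h a + d], whose square is at least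
   [h a ^+ 2 + d ^+ 2], too large for a minimizing sequence. *)
pose d := (h p - h a) / 2.
have d0 : 0 < d by rewrite divr_gt0 ?subr_gt0.
have d20 : 0 < d ^+ 2 by rewrite exprn_gt0.
have [N1 _ P1] := near_infty_natSinv_lt (PosNum d20).
have /cvgrPdist_lt/(_ _ d0)[N2 _ P2] := ucvg.
pose n := maxn N1 N2.
have p1 : n.+1%:R^-1 < d ^+ 2 := P1 n (leq_maxl _ _).
have p2 : `|p - u n| < d := P2 n (leq_maxr _ _).
have hun : h a + d < h (u n).
  by have := hlip p (u n); rewrite /d in p2 *; lra.
have : (h a + d) ^+ 2 < h (u n) ^+ 2.
  by rewrite ltr_pXn2r ?nnegrE ?addr_ge0 ?(ltW d0).
have := uD n; have := Dle _ Aa.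
have : 0 <= h a * d by rewrite mulr_ge0 ?(ltW d0).
by rewrite sqrrD; move: (inf E) (n.+1%:R^-1) p1 => D r; lra.
Qed.

End minimizer.

(** * Metric projections and reflections *)

Section projection.
Context {R : realType} {H : hilbertType R}.
Implicit Types (A : set H) (a b p x y : H).
Local Notation "<< a , b >>" := (@inner R H a b)
  (at level 0, format "<< a ,  b >>").
Local Notation P := metric_proj.

Lemma convex_set_comb A a b (t : R) : convex_set A -> A a -> A b ->
  0 <= t -> t <= 1 -> A (t *: a + (1 - t) *: b).
Proof.
move=> Acv Aa Ab t0 t1; apply: set_mem.
by apply: (Acv a b (Itv01 t0 t1)); apply: mem_set.
Qed.

Lemma metric_proj_nearest A x : closed A -> convex_set A -> A !=set0 ->
  is_nearest_point A x (P A x).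
Proof.
move=> Acl Acv A0; apply: xgetPex.
have [||||p Ap pP] := @exists_minimizer _ _ A (fun a => `|x - a|) Acl A0.
- move=> a b Aa Ab.
  have -> : 2^-1 *: (a + b) = 2^-1 *: a + (1 - 2^-1) *: b.
    by rewrite scalerDr; congr (_ + _ *: _); field.
  by apply: convex_set_comb => //; lra.
- by [].
- by move=> a b; rewrite (distrC a b); exact: ler_distD.
- move=> a b. exact: sqr_norm_midpoint.
- by exists p; split.
Qed.

Lemma nearest_inner_le0 A x p a : convex_set A -> is_nearest_point A x p ->
  A a -> <<x - p, a - p>> <= 0.
Proof.
move=> Acv [Ap pmin] Aa; set e := <<_, _>>; rewrite leNgt; apply/negP => e0.
have N0 : 0 <= `|a - p| ^+ 2 by exact: sqr_ge0.
have Ne0 : 0 < `|a - p| ^+ 2 + e by lra.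
(* Moving from [p] towards [a] by the fraction [t] changes the squared distance to [x] by
   [t * (t * N - 2 * e)], with [N] the squared norm of [a - p]. This is negative since [t * N < e];
   the summand [e] in the denominator keeps [t <= 1]. *)
pose t := e / (`|a - p| ^+ 2 + e).
have t0 : 0 < t by rewrite divr_gt0.
have t1 : t <= 1 by rewrite ler_pdivrMr // mul1r; lra.
have tE : t * (`|a - p| ^+ 2 + e) = e by rewrite divfK // gt_eqF.
have := pmin _ (convex_set_comb Acv Aa Ap (ltW t0) t1).
have -> : x - (t *: a + (1 - t) *: p) = (x - p) - t *: (a - p).
  rewrite scalerBl scalerBr scale1r !opprD !opprK !addrA; congr (_ + _).
  by rewrite -!addrA; congr (_ + _); rewrite addrC.
rewrite -ler_sqr_norm (sqr_normB _ (t *: _)) sqr_normZ innerZr -/e.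
by nra.
Qed.

Section convex_proj.
Variable A : set H.
Hypotheses (Acl : closed A) (Acv : convex_set A) (A0 : A !=set0).

Lemma metric_proj_in x : A (P A x).
Proof. by have [] := metric_proj_nearest x Acl Acv A0. Qed.

Lemma metric_proj_inner_le0 x a : A a -> <<x - P A x, a - P A x>> <= 0.
Proof. exact: nearest_inner_le0 (metric_proj_nearest x Acl Acv A0). Qed.

Lemma metric_proj_sqr_le x a : A a ->
  `|x - P A x| ^+ 2 + `|P A x - a| ^+ 2 <= `|x - a| ^+ 2.
Proof.
move=> /(metric_proj_inner_le0 x).
have -> : x - a = (x - P A x) - (a - P A x) by rewrite opprB addrA subrK.
by rewrite (sqr_normB (x - _)) (distrC _ a); lra.
Qed.

Lemma metric_proj_id a : A a -> P A a = a.
Proof.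
move=> Aa; have := metric_proj_sqr_le a Aa; rewrite subrr normr0 expr0n /=.
rewrite (distrC a) => h.
have h0 : `|P A a - a| ^+ 2 = 0 by have := sqr_ge0 `|P A a - a|; lra.
by apply/eqP; rewrite -subr_eq0 -normr_eq0 -sqrf_eq0 h0.
Qed.

(** The sum of two obtuse-angle conditions, each tested at the other projection. *)
Lemma metric_proj_firm x y :
  `|P A x - P A y| ^+ 2 <= <<P A x - P A y, x - y>>.
Proof.
have := metric_proj_inner_le0 x (metric_proj_in y).
have := metric_proj_inner_le0 y (metric_proj_in x).
set p := P A x; set q := P A y.
rewrite normE_inner !innerE (innerC q p) (innerC p x) (innerC p y).
by rewrite (innerC q x) (innerC q y); lra.
Qed.

(** In the expanded square, the terms involving the projections add up to four times the difference
    of the two sides of [metric_proj_firm]. *)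
Lemma reflector_nonexpansive x y : `|reflector A x - reflector A y| <= `|x - y|.
Proof.
have := metric_proj_firm x y; rewrite -ler_sqr_norm /reflector.
set p := P A x; set q := P A y.
have -> : 2 *: p - x - (2 *: q - y) = 2 *: (p - q) - (x - y).
  by rewrite scalerBr !opprB [y - _]addrC addrACA [- x + y]addrC.
by rewrite (sqr_normB (2 *: _)) sqr_normZ innerZl; lra.
Qed.

Lemma reflector_id a : A a -> reflector A a = a.
Proof.
by move=> Aa; rewrite /reflector metric_proj_id // scaler_nat mulr2n addrK.
Qed.

End convex_proj.
End projection.

(** * Douglas-Rachford operators and their fixed points *)

Section douglas_rachford.
Context {R : realType} {H : hilbertType R}.
Implicit Types (A B : set H) (a b c p x y z : H).
Local Notation "<< a , b >>" := (@inner R H a b)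
  (at level 0, format "<< a ,  b >>").
Local Notation P := metric_proj.

Lemma midpoint_fixedE x y : 2^-1 *: (x + y) = x -> y = x.
Proof.
move=> /(congr1 (fun v => 2 *: v)); rewrite scalerA divff ?scale1r //.
by rewrite scaler_nat mulr2n => /addrI.
Qed.

(** The midpoint identity loses a quarter of the squared norm of [x - N x], which is exactly the
    squared residual. *)
Lemma averaged_fejer (N : H -> H) x z :
  (forall a b, `|N a - N b| <= `|a - b|) -> N z = z ->
  `|2^-1 *: (x + N x) - z| ^+ 2 + `|x - 2^-1 *: (x + N x)| ^+ 2
    <= `|x - z| ^+ 2.
Proof.
move=> /(_ x z) h Nz; move: h; rewrite Nz -ler_sqr_norm (distrC (2^-1 *: _)).
rewrite !sqr_norm_midpoint subrr normr0 expr0n /= (distrC z x) (distrC z).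
by lra.
Qed.

Section two_sets.
Variables A B : set H.
Hypotheses (Acl : closed A) (Acv : convex_set A) (A0 : A !=set0).
Hypotheses (Bcl : closed B) (Bcv : convex_set B) (B0 : B !=set0).
Local Notation T := (DR A B).

Lemma reflector_comp_nonexpansive x y :
  `|reflector B (reflector A x) - reflector B (reflector A y)| <= `|x - y|.
Proof.
by apply: le_trans (reflector_nonexpansive _ _ _ _ _) _ => //;
  apply: reflector_nonexpansive.
Qed.

Lemma DR_nonexpansive x y : `|T x - T y| <= `|x - y|.
Proof.
rewrite /DR -scalerBr normrZ gtr0_norm ?invr_gt0 // opprD addrACA.
have := ler_normD (x - y) (reflector B (reflector A x)
  - reflector B (reflector A y)).
have := reflector_comp_nonexpansive x y.
by lra.
Qed.

Lemma DR_fejer x z : T z = z ->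
  `|T x - z| ^+ 2 + `|x - T x| ^+ 2 <= `|x - z| ^+ 2.
Proof.
move=> /midpoint_fixedE Nz.
exact: (averaged_fejer x reflector_comp_nonexpansive Nz).
Qed.

Lemma DR_id z : A z -> B z -> T z = z.
Proof.
move=> Az Bz; rewrite /DR !reflector_id //.
by rewrite -mulr2n -[z *+ 2]scaler_nat scalerA mulVf ?scale1r.
Qed.

(** With [y] the reflection of [x] into [A], being fixed means that [B] reflects [y] back to [x], so
    both projections are the midpoint of [x] and [y]. *)
Lemma DR_fixed_proj x : T x = x -> P B (reflector A x) = P A x.
Proof.
move=> /midpoint_fixedE; set y := reflector A x.
have xy : x + y = 2 *: P A x by rewrite addrC subrK.
move=> /(canRL (subrK _)); rewrite xy => /(congr1 (fun v => 2^-1 *: v)).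
by rewrite !scalerA mulVf ?scale1r.
Qed.

Lemma DR_fixed_in x : T x = x -> A (P A x) /\ B (P A x).
Proof.
by move=> Tx; split; [|rewrite -DR_fixed_proj //]; apply: metric_proj_in.
Qed.

(* [P A x] is also the projection onto [B] of the reflected point
   [2 P A x - x], so the two obtuse-angle conditions have opposite signs. *)
Lemma DR_fixed_orthogonal x c : T x = x -> A c -> B c ->
  <<x - P A x, c - P A x>> = 0.
Proof.
move=> Tx Ac Bc; have := metric_proj_inner_le0 Acl Acv A0 x Ac.
have := metric_proj_inner_le0 Bcl Bcv B0 (reflector A x) Bc.
rewrite DR_fixed_proj // /reflector.
have -> : 2 *: P A x - x - P A x = - (x - P A x).
  by rewrite scaler_nat mulr2n addrAC addrK opprB.
by rewrite innerNl; lra.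
Qed.

(** By [DR_fixed_orthogonal], [x - P A x] is orthogonal to [c' - P A x] for every [c'] in a ball
    around [c], hence to every direction, including its own. *)
Lemma DR_fixed_interior x c : T x = x -> interior (A `&` B) c -> P A x = x.
Proof.
move=> Tx /nbhs_ballP[e /= e0 ballAB].
(* [t *: v] has norm below [e]; the [+ 1] covers [v = 0]. *)
set v := x - P A x; pose t := e / (2 * (`|v| + 1)).
have v1 : 0 < 2 * (`|v| + 1) by rewrite mulr_gt0 // ltr_wpDl.
have t0 : 0 < t by rewrite divr_gt0.
have [Ac Bc] : (A `&` B) c by apply: ballAB; exact: ballxx.
have [At Bt] : (A `&` B) (c + t *: v).
  apply: ballAB; rewrite -ball_normE /= opprD addNKr normrN normrZ gtr0_norm //.
  by rewrite /t mulrAC ltr_pdivrMr // ltr_pM2l //; have := normr_ge0 v; lra.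
have := DR_fixed_orthogonal Tx At Bt.
rewrite addrAC innerDr (DR_fixed_orthogonal Tx Ac Bc) add0r innerZr.
rewrite -normE_inner -/v => /eqP; rewrite mulf_eq0 gt_eqF //= sqrf_eq0.
by rewrite normr_eq0 subr_eq0 => /eqP <-.
Qed.

End two_sets.

(* Going once around the cycle, the distance from [x] to the projections
   cannot increase, so all projections coincide. *)
Lemma cyclic_DR_fixed (g : nat) (D : 'I_g -> set H) x :
  (forall l, closed (D l)) -> (forall l, convex_set (D l)) ->
  (forall l, D l !=set0) ->
  (forall l, DR (D l) (D (ordS l)) x = x) -> forall l j, D j (P (D l) x).
Proof.
move=> Dcl Dcv D0 Dfix.
have step l : P (D (ordS l)) x = P (D l) x.
  pose d k := `|x - P (D k) x| ^+ 2.
  pose s k := `|P (D (ordS k)) x - P (D k) x| ^+ 2.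
  have dle k : d (ordS k) + s k <= d k.
    by apply: metric_proj_sqr_le => //; have [] := DR_fixed_in
      (Dcl k) (Dcv k) (D0 k) (Dcl _) (Dcv _) (D0 _) (Dfix k).
  have s0 k : true -> 0 <= s k by rewrite sqr_ge0.
  (* Since [ordS] permutes the indices, the [d] terms cancel when [dle] is summed over the cycle. *)
  have sum0 : \sum_k s k = 0.
    apply/eqP; rewrite eq_le sumr_ge0 // andbT.
    rewrite -(lerD2l (\sum_k d k)) addr0.
    rewrite [X in X + _](reindex_inj (@ordS_inj g)) -big_split /=.
    exact: ler_sum.
  have /eqP := psumr_eq0P s0 sum0 (i := l) isT.
  by rewrite sqrf_eq0 normr_eq0 subr_eq0 => /eqP.
(* Iterating [step] upwards from index 0 identifies every projection with the one at index 0. *)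
have const n (l j : 'I_g) :
    l = n :> nat -> j = 0%N :> nat -> P (D l) x = P (D j) x.
  elim: n l => [|n IH] l ln j0.
    by congr (P (D _) x); apply: val_inj; rewrite /= ln j0.
  have ng : (n < g)%N by rewrite ltnW // -ln.
  rewrite -(IH (Ordinal ng)) // -(step (Ordinal ng)).
  congr (P (D _) x); apply: val_inj.
  by rewrite /= modn_small -?ln.
move=> l j; have g0 : (0 < g)%N by case: (g) l => [[]|].
rewrite (const l l (Ordinal g0)) // -(const j j (Ordinal g0)) //.
exact: metric_proj_in.
Qed.

(** * Convex combinations over a block *)

Section block.
Variables (m : nat) (C : 'I_m -> set H).
Hypotheses (C_closed : forall i, closed (C i))
  (C_convex : forall i, convex_set (C i)) (C0 : forall i, C i !=set0).
Variables (g : nat) (i : 'I_g -> 'I_m) (w : 'I_g -> R).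
Hypotheses (w_gt0 : forall l, 0 < w l) (w_sum1 : \sum_(l < g) w l = 1).
Local Notation T l := (DR (C (i l)) (C (i (ordS l)))).
Local Notation Q := (block_DR C i w).

Lemma block_DR_subl x z : z - Q x = \sum_(l < g) w l *: (z - T l x).
Proof.
under eq_bigr do rewrite scalerBr.
by rewrite sumrB -scaler_suml w_sum1 scale1r.
Qed.

Lemma block_DR_step x :
  `|x - Q x| ^+ 2 <= \sum_(l < g) w l * `|x - T l x| ^+ 2.
Proof. by rewrite block_DR_subl; exact: sqr_norm_sum_le. Qed.

(** Convexity of the squared norm reduces this to the weighted sum of the inequalities
    [DR_fejer]. *)
Lemma block_DR_fejer x z : (forall l, T l z = z) ->
  `|Q x - z| ^+ 2 + \sum_(l < g) w l * `|x - T l x| ^+ 2 <= `|x - z| ^+ 2.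
Proof.
move=> Tz; rewrite distrC block_DR_subl.
have -> : `|x - z| ^+ 2 = \sum_(l < g) w l * `|x - z| ^+ 2.
  by rewrite -mulr_suml w_sum1 mul1r.
apply: le_trans (lerD (sqr_norm_sum_le _ w_gt0 w_sum1) (lexx _)) _.
rewrite -big_split /=; apply: ler_sum => l _.
by rewrite -mulrDr (distrC z) ler_pM2l // DR_fejer.
Qed.

End block.
End douglas_rachford.

(** * Ultrafilter limits, demiclosedness and Opial's argument *)

Section ultralimits.
Context {R : realType}.

(** If the preimage of a neighborhood were not in [F], then [F] and the complement of that preimage
    would lie in a common ultrafilter, contradicting convergence along it. *)
Lemma cvg_ultra (T : Type) (V : topologicalType) (F : set_system T) (f : T -> V)
    (l : V) :
  Filter F -> (forall U, UltraFilter U -> F `<=` U -> f @ U --> l) ->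
  f @ F --> l.
Proof.
move=> FF fU A lA; apply: contrapT => nFA.
have WP : ProperFilter (within (~` (f @^-1` A)) F).
  apply: Build_ProperFilter_ex => B FB; apply: contrapT => nB; apply: nFA.
  apply: (@filterS _ F _ _ _ _ FB) => x xB.
  by apply: contrapT => nAx; apply: nB; exists x; exact: xB.
have [U [Uu WU]] := ultraFilterLemma WP.
have FU : F `<=` U.
  by move=> B FB; apply: WU; apply: (@filterS _ F _ _ _ _ FB) => x.
have UA : U (f @^-1` A) by exact: fU lA.
have UnA : U (~` (f @^-1` A)) by apply: WU; apply: (@filterE _ F) => x.
by have [x [fx nfx]] := filter_ex (filterI UA UnA); exact: nfx.
Qed.

(** Compactness of the segment gives a cluster point, and along an ultrafilter a cluster point is a
    limit. *)
Lemma bounded_ultra_cvg (T : Type) (U : set_system T) (f : T -> R) (B : R) :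
  UltraFilter U -> (forall n, `|f n| <= B) -> exists l : R, f @ U --> l.
Proof.
move=> Uu fB.
have [|l [_ lcl]] := @segment_compact R (- B) B (f @ U) _.
  by apply: (@filterE _ U) => n; rewrite /= in_itv /= -ler_norml.
exists l => A lA; have [//|UnA] := in_ultra_setVsetC (f @^-1` A) Uu.
by have [x [nAx Ax]] := lcl (~` A) A UnA lA; case: nAx.
Qed.

Lemma cvg_sqr (T : Type) (U : set_system T) {UF : Filter U}
    (f : T -> R) (l : R) :
  f @ U --> l -> f n ^+ 2 @[n --> U] --> l ^+ 2.
Proof.
by move=> fl; rewrite expr2; under eq_fun do rewrite expr2; exact: cvgM.
Qed.

Context {H : hilbertType R}.
Implicit Types (U : set_system nat) (y : nat -> H) (a b c u z : H) (F : set H).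
Local Notation "<< a , b >>" := (@inner R H a b)
  (at level 0, format "<< a ,  b >>").

Definition weakly_cvg_along U y c :=
  forall u, <<y n, u>> @[n --> U] --> <<c, u>>.

(** Cruder than Cauchy-Schwarz, but enough to bound [<<y n, v>>] uniformly in [n]. *)
Lemma inner_bound a b : `|<<a, b>>| <= `|a| ^+ 2 + `|b| ^+ 2.
Proof.
have := sqr_ge0 `|a + b|; have := sqr_ge0 `|a - b|.
rewrite sqr_normB sqr_normD => h1 h2.
by have := sqr_ge0 `|a|; have := sqr_ge0 `|b|; rewrite ler_norml; lra.
Qed.

(** Expanding around [c] leaves a cross term that vanishes by weak convergence. This is the
    quantitative form of Opial's property. *)
Lemma weak_dist U {UF : Filter U} y c z (r : R) : weakly_cvg_along U y c ->
  `|y n - c| @[n --> U] --> r ->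
  `|y n - z| ^+ 2 @[n --> U] --> r ^+ 2 + `|z - c| ^+ 2.
Proof.
move=> yc yr.
have E n : `|y n - z| ^+ 2 = `|y n - c| * `|y n - c| +
    2 * (<<y n, c - z>> - <<c, c - z>>) + `|z - c| ^+ 2.
  rewrite -(subrKA c (y n)) (sqr_normD (y n - c)) innerBl (distrC c z); ring.
under eq_fun do rewrite E.
apply: cvgD; last exact: cvg_cst.
rewrite -[X in _ --> X]addr0; apply: cvgD; first exact: cvgM.
rewrite -[X in _ --> X](mulr0 2); apply: cvgM; first exact: cvg_cst.
by rewrite -[X in _ --> X](subrr <<c, c - z>>); apply: cvgB; [|exact: cvg_cst].
Qed.

Section bounded.
Variables (y : nat -> H) (B : R).
Hypothesis yB : forall n, `|y n| <= B.

Lemma dist_ultra_cvg U z : UltraFilter U ->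
  exists r : R, `|y n - z| @[n --> U] --> r.
Proof.
move=> Uu; apply: (@bounded_ultra_cvg _ U _ (B + `|z|)) => n.
by rewrite normr_id (le_trans (ler_normB _ _)) // lerD2r.
Qed.

(* The asymptotic center of [y] along [U], i.e. the minimizer of
   [z |-> lim_U |y n - z|], is the weak limit of [y] along [U]. *)
Lemma bounded_weak_ultra_cvg U : UltraFilter U ->
  exists c, weakly_cvg_along U y c.
Proof.
move=> Uu.
have /choice[h hP] z := dist_ultra_cvg z Uu.
have hsq z : `|y n - z| ^+ 2 @[n --> U] --> h z ^+ 2.
  exact: cvg_sqr.
have h0 z : 0 <= h z by apply: (cvgr_to_ge (hP z)); exact: nearW.
have hlip a b : h a <= h b + `|a - b|.
  have hb : `|y n - b| + `|a - b| @[n --> U] --> h b + `|a - b|.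
    by apply: cvgD; [exact: hP|exact: cvg_cst].
  apply: (ler_cvg_to (hP a) hb); apply: nearW => n.
  by rewrite (distrC a b); exact: ler_distD.
have hmid a b : h (2^-1 *: (a + b)) ^+ 2 =
    2^-1 * h a ^+ 2 + 2^-1 * h b ^+ 2 - 4^-1 * `|a - b| ^+ 2.
  apply: (cvg_unique _ (hsq _)) => //=.
  under eq_fun do rewrite sqr_norm_midpoint.
  apply: cvgB; last exact: cvg_cst.
  by apply: cvgD; apply: cvgM; (exact: cvg_cst || exact: hsq).
have [||c _ cmin] := @exists_minimizer _ _ setT h closedT _ _ h0 hlip hmid.
- by exists 0.
- by [].
exists c => v.
have [e eP] := @bounded_ultra_cvg _ U (fun n => <<y n, v>>)
  (B ^+ 2 + `|v| ^+ 2) Uu (fun n => le_trans (inner_bound _ _)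
    (lerD (lerXn2r 2 (normr_ge0 _ : `|y n| \in Num.nneg)
     (le_trans (normr_ge0 _) (yB n)) (yB n)) (lexx _))).
suff -> : <<c, v>> = e by [].
(* Moving the center [c] by [(d * s) *: v] changes the squared value of [h] by
   [- d ^+ 2 * s * (1 + s)], so minimality forces [d = 0]. The [+ 1] in [s] covers [v = 0]. *)
pose d := e - <<c, v>>; pose s := (`|v| ^+ 2 + 1)^-1.
have N0 := sqr_ge0 `|v|.
have sE : s * (`|v| ^+ 2 + 1) = 1 by rewrite mulVf // gt_eqF // ltr_wpDl.
have s0 : 0 < s by rewrite invr_gt0 ltr_wpDl.
have expand t : h (c + t *: v) ^+ 2 = h c ^+ 2 - 2 * t * d + t ^+ 2 * `|v| ^+ 2.
  apply: (cvg_unique _ (hsq _)) => //=.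
  have E n : `|y n - (c + t *: v)| ^+ 2 = `|y n - c| ^+ 2
      - (2 * t) * (<<y n, v>> - <<c, v>>) + t ^+ 2 * `|v| ^+ 2.
    rewrite opprD addrA (sqr_normB (y n - c)) sqr_normZ innerZr innerBl.
    by ring.
  under eq_fun do rewrite E.
  apply: cvgD; last exact: cvg_cst.
  apply: cvgB; first exact: hsq.
  apply: cvgM; first exact: cvg_cst.
  by apply: cvgB; [exact: eP|exact: cvg_cst].
have : h c ^+ 2 <= h (c + (d * s) *: v) ^+ 2.
  by rewrite ler_pXn2r ?nnegrE // cmin.
rewrite expand => hd.
have d0 : d ^+ 2 * s <= 0.
  have : d ^+ 2 * s * (s * (`|v| ^+ 2 + 1)) = d ^+ 2 * s by rewrite sE mulr1.
  have : 0 <= d ^+ 2 * s ^+ 2 by rewrite mulr_ge0 ?sqr_ge0.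
  have : 0 <= d ^+ 2 * s by rewrite mulr_ge0 ?sqr_ge0 ?ltW.
  by nra.
have : d ^+ 2 <= 0 by rewrite -(pmulr_lle0 _ s0).
rewrite le_eqVlt ltNge sqr_ge0 orbF sqrf_eq0 subr_eq0 => /eqP ->.
by [].
Qed.

(** Let [r] and [q] be the limit distances to [c] and [T c]. Vanishing residuals and
    nonexpansiveness give [q <= r], whereas by [weak_dist] [q ^+ 2] exceeds [r ^+ 2] by the squared
    norm of [T c - c]. *)
Lemma demiclosed U c (T : H -> H) : UltraFilter U ->
  (forall a b, `|T a - T b| <= `|a - b|) -> weakly_cvg_along U y c ->
  `|y n - T (y n)| @[n --> U] --> (0 : R) -> T c = c.
Proof.
move=> Uu Tne yc yT.
have [r yr] := dist_ultra_cvg c Uu.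
have [q yq] := dist_ultra_cvg (T c) Uu.
have q0 : 0 <= q by apply: (cvgr_to_ge yq); exact: nearW.
have r0 : 0 <= r by apply: (cvgr_to_ge yr); exact: nearW.
have qr : q <= r.
  have s : `|y n - T (y n)| + `|y n - c| @[n --> U] --> r.
    by rewrite -[r in X in _ --> X]add0r; exact: cvgD.
  apply: (ler_cvg_to yq s); apply: nearW => n.
  by rewrite (le_trans (ler_distD (T (y n)) _ _)) // lerD2l.
have qE : q ^+ 2 = r ^+ 2 + `|T c - c| ^+ 2.
  apply: (cvg_unique _ (cvg_sqr yq)) => //.
  exact: weak_dist.
have : q ^+ 2 <= r ^+ 2 by rewrite ler_pXn2r.
rewrite qE gerDl => d0; apply/eqP; rewrite -subr_eq0 -normr_eq0 -sqrf_eq0.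
by rewrite eq_le d0 sqr_ge0.
Qed.

(** The distances to two weak ultrafilter limits converge along the whole sequence. Applying
    [weak_dist] along each ultrafilter makes each squared limit exceed the other by the squared norm
    of [c - c'], which is therefore 0. *)
Lemma opial_weakly_cvg F :
  (forall z, F z -> exists r : R, `|y n - z| @[n --> \oo] --> r) ->
  (forall U c, UltraFilter U -> \oo `<=` U -> weakly_cvg_along U y c -> F c) ->
  exists2 c, F c & weakly_cvg_to y c.
Proof.
move=> Fcvg Fcl.
have [U0 [U0u U0oo]] := @ultraFilterLemma nat \oo _.
have [c yc] := bounded_weak_ultra_cvg U0u.
have Fc := Fcl _ _ U0u U0oo yc.
exists c => // u; apply: cvg_ultra => U Uu Uoo.
have [c' yc'] := bounded_weak_ultra_cvg Uu.
have Fc' := Fcl _ _ Uu Uoo yc'.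
suff -> : c = c' by exact: yc'.
have [r yr] := Fcvg _ Fc; have [r' yr'] := Fcvg _ Fc'.
have sub (V : set_system nat) : \oo `<=` V -> forall (f : nat -> R) (l : R),
    f n @[n --> \oo] --> l -> f n @[n --> V] --> l.
  by move=> ooV f l fl A /fl /ooV.
have e1 : r' ^+ 2 = r ^+ 2 + `|c' - c| ^+ 2.
  apply: (cvg_unique _ (cvg_sqr (sub _ U0oo _ _ yr'))) => //.
  exact: weak_dist (sub _ U0oo _ _ yr).
have e2 : r ^+ 2 = r' ^+ 2 + `|c - c'| ^+ 2.
  apply: (cvg_unique _ (cvg_sqr (sub _ Uoo _ _ yr))) => //.
  exact: weak_dist (sub _ Uoo _ _ yr').
apply/eqP; rewrite -subr_eq0 -normr_eq0 -sqrf_eq0.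
by apply/eqP; move: e1 e2; rewrite (distrC c'); lra.
Qed.

End bounded.
End ultralimits.

(** * Fejer monotone sequences *)

Section fejer.
Context {R : realType} {H : hilbertType R}.
Implicit Types (x : nat -> H) (F : set H) (z : H).

Lemma fejer_dist_cvg x z : (forall k, `|x k.+1 - z| <= `|x k - z|) ->
  exists r : R, `|x k - z| @[k --> \oo] --> r.
Proof.
move=> xz; exists (lim (`|x k - z| @[k --> \oo])).
apply: nonincreasing_is_cvgn; first exact/nonincreasing_seqP.
by exists 0 => _ [k _ <-].
Qed.

Lemma fejer_gap_cvg0 x z : (forall k, `|x k.+1 - z| <= `|x k - z|) ->
  `|x k - z| ^+ 2 - `|x k.+1 - z| ^+ 2 @[k --> \oo] --> (0 : R).
Proof.
move=> /fejer_dist_cvg[r /cvg_sqr xr]; rewrite -[X in _ --> X](subrr (r ^+ 2)).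
by apply: cvgB => //; rewrite -(cvg_shiftS (fun k => `|x k - z| ^+ 2)) in xr.
Qed.

(* Testing Fejer monotonicity at [z - s *: d], with [d] the step
   [x k.+1 - x k] and [s *: d] of length [e / 2], bounds [e * |d|] by the
   decrease of [|x k - z| ^+ 2]; hence the steps are summable. *)
Lemma fejer_interior_cvg x F z :
  (forall k z, F z -> `|x k.+1 - z| <= `|x k - z|) -> interior F z ->
  cvg (x @ \oo).
Proof.
move=> xF /nbhs_ballP[e /= e0 ballF].
have r0 : 0 < e / 2 by rewrite divr_gt0.
pose a k : R := `|x k - z| ^+ 2.
have step k : e * `|x k.+1 - x k| <= a k - a k.+1.
  set d := x k.+1 - x k.
  have ak : a k.+1 = `|(x k - z) + d| ^+ 2.
    by rewrite /a /d (addrC (x k - z)) subrKA.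
  have [d0|d0] := eqVneq d 0.
    by rewrite ak d0 addr0 normr0 mulr0 /a subrr.
  have nd0 : 0 < `|d| by rewrite normr_gt0.
  pose s := (e / 2) / `|d|.
  have s0 : 0 < s by rewrite divr_gt0.
  have sd : s * `|d| = e / 2 by rewrite divfK // gt_eqF.
  have Fz : F (z - s *: d).
    apply: ballF; rewrite -ball_normE /= opprB addrC subrK normrZ gtr0_norm //.
    by rewrite sd; lra.
  have := xF k _ Fz; rewrite -ler_sqr_norm.
  have -> : x k - (z - s *: d) = x k - z + s *: d by rewrite opprB addrCA addrC.
  have -> : x k.+1 - (z - s *: d) = x k - z + d + s *: d.
    by rewrite opprB addrCA addrC [x k - z + d]addrC /d addrA subrK.
  rewrite !(sqr_normD _ (s *: d)) -ak -/(a k) !innerZr.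
  rewrite (innerDl (x k - z)) -(normE_inner d).
  have : s * `|d| ^+ 2 = e / 2 * `|d| by rewrite expr2 mulrA sd.
  by by move: (inner _ _) => q; lra.
have tail n k : e * `|x (n + k)%N - x n| <= a n - a (n + k)%N.
  elim: k => [|k IH]; first by rewrite addn0 !subrr normr0 mulr0.
  have := ler_distD (x (n + k)%N) (x (n + k).+1) (x n).
  rewrite addnS => /(ler_wpM2l (ltW e0)); rewrite mulrDr.
  by have := step (n + k)%N; lra.
have Fz : F z by apply: ballF; exact: ballxx.
have [r /cvg_sqr ar] := fejer_dist_cvg (fun k => xF k z Fz).
have alow n : r ^+ 2 <= a n.
  apply: (cvgr_to_le ar); exists n => // m /= /subnKC <-.
  have := tail n (m - n)%N; have := normr_ge0 (x (n + (m - n))%N - x n).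
  by rewrite -(pmulr_rge0 _ e0) -/(a _); lra.
apply: cauchy_cvg; apply/cauchyP => eps eps0.
have ee0 : 0 < e * eps by rewrite mulr_gt0.
have /cvgrPdist_lt/(_ _ ee0)[N _ NP] := ar.
exists (x N); exists N => // n /= Nn; rewrite -ball_normE /= distrC.
rewrite -(ltr_pM2l e0) -{1}(subnKC Nn).
(* The telescoped bound is at most [a N - r ^+ 2], because [a] stays above its limit [r ^+ 2]. *)
apply: le_lt_trans (tail _ _) _.
have : `|r ^+ 2 - a N| < e * eps := NP _ (leqnn N).
by have := alow (N + (n - N))%N; rewrite ltr_norml => + /andP[]; lra.
Qed.

End fejer.

(** * Null sequences of reals *)

Lemma cvg0_of_sqr_le {R : realType} (c : R) (f d : nat -> R) : 0 < c ->
  (forall n, 0 <= f n) -> (forall n, c * f n ^+ 2 <= d n) ->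
  d n @[n --> \oo] --> (0 : R) -> f n @[n --> \oo] --> (0 : R).
Proof.
move=> c0 f0 fd d0; apply/cvgr0Pnorm_lt => e e0.
have ce0 : 0 < c * e ^+ 2 by rewrite mulr_gt0 // exprn_gt0.
have /cvgr0Pnorm_lt/(_ _ ce0)[N _ NP] := d0.
exists N => // n /NP /= dn.
rewrite ger0_norm // -(@ltr_pXn2r _ 2) ?nnegrE ?(ltW e0) // -(ltr_pM2l c0).
exact: le_lt_trans (le_trans (fd n) (ler_norm _)) dn.
Qed.

Lemma cvg0D {R : realType} (g h : nat -> R) :
  g n @[n --> \oo] --> (0 : R) -> h n @[n --> \oo] --> (0 : R) ->
  g n + h n @[n --> \oo] --> (0 : R).
Proof. by move=> g0 h0; rewrite -[X in _ --> X](addr0 0); exact: cvgD. Qed.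

Lemma cvg0_le {R : realType} (f g : nat -> R) :
  g n @[n --> \oo] --> (0 : R) -> (forall n, 0 <= f n <= g n) ->
  f n @[n --> \oo] --> (0 : R).
Proof.
move=> g0 fg; apply: (@squeeze_cvgr _ _ _ _ (fun=> 0) g) => //.
- exact: nearW.
- exact: cvg_cst.
Qed.

(** * The block iteration and its sweeps *)

Section block_iteration.
Context {R : realType} {H : hilbertType R}.
Variables (m : nat) (C : 'I_m -> set H).
Hypotheses (C_closed : forall i, closed (C i))
  (C_convex : forall i, convex_set (C i))
  (C_meet : \bigcap_(i in [set: 'I_m]) C i !=set0).
Variables (M : nat) (M_gt0 : (0 < M)%N) (gamma : 'I_M -> nat)
  (idx : forall t : 'I_M, 'I_(gamma t) -> 'I_m)
  (w : forall t : 'I_M, 'I_(gamma t) -> R).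
Arguments idx : clear implicits.
Arguments w : clear implicits.
Hypotheses (w_gt0 : forall t l, 0 < w t l)
  (w_sum1 : forall t, \sum_(l < gamma t) w t l = 1).
Arguments w_gt0 : clear implicits.
Variable x : nat -> H.
Hypothesis x_rec : forall k, let t := Ordinal (ltn_pmod k M_gt0) in
  x k.+1 = block_DR C (idx t) (w t) (x k).

Local Notation T t l := (DR (C (idx t l)) (C (idx t (ordS l)))).

Definition common_fixed : set H := [set z | forall t l, T t l z = z].

Let C0 i : C i !=set0.
Proof. by have [z Cz] := C_meet; exists z; exact: Cz. Qed.

Let DR_C_nonexpansive i j a b :
  `|DR (C i) (C j) a - DR (C i) (C j) b| <= `|a - b|.
Proof. exact: DR_nonexpansive. Qed.

Lemma bigcap_common_fixed z :
  (\bigcap_(i in [set: 'I_m]) C i) z -> common_fixed z.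
Proof. by move=> Cz t l; apply: DR_id => //; exact: Cz. Qed.

Lemma block_iteration_fejer k z : common_fixed z ->
  `|x k.+1 - z| <= `|x k - z|.
Proof.
move=> Fz; rewrite -ler_sqr_norm x_rec; set t := Ordinal _.
have := block_DR_fejer C_closed C_convex C0 (w_gt0 t) (w_sum1 t) (x k) (Fz t).
apply: le_trans; rewrite lerDl; apply: sumr_ge0 => l _.
by rewrite mulr_ge0 ?sqr_ge0 ?ltW.
Qed.

(** The squared step is at most the weighted sum of squared residuals, which the vanishing Fejer gap
    dominates. *)
Lemma block_iteration_step_cvg0 : `|x k - x k.+1| @[k --> \oo] --> (0 : R).
Proof.
have [z /bigcap_common_fixed Fz] := C_meet.
have := fejer_gap_cvg0 (fun k => block_iteration_fejer k Fz).
apply: (@cvg0_of_sqr_le _ 1) => // k; rewrite mul1r x_rec; set t := Ordinal _.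
have := block_DR_fejer C_closed C_convex C0 (w_gt0 t) (w_sum1 t) (x k) (Fz t).
have := block_DR_step C (idx t) (w_gt0 t) (w_sum1 t) (x k).
by lra.
Qed.

Lemma cvg_mulnD j : (n * M + j)%N @[n --> \oo] --> \oo.
Proof.
move=> A [N _ NA]; exists N => // n /= Nn; apply: NA => /=.
by rewrite (leq_trans Nn) // (leq_trans _ (leq_addr _ _)) // leq_pmulr.
Qed.

Lemma sweep_dist_cvg0 j :
  `|x (n * M)%N - x (n * M + j)%N| @[n --> \oo] --> (0 : R).
Proof.
elim: j => [|j IH].
  by under eq_fun do rewrite addn0 subrr normr0; exact: cvg_cst.
have s : `|x (n * M + j)%N - x (n * M + j).+1| @[n --> \oo] --> (0 : R).
  exact: (cvg_comp _ _ (@cvg_mulnD j) block_iteration_step_cvg0).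
apply: (cvg0_le (cvg0D IH s)) => n.
by rewrite normr_ge0 addnS ler_distD.
Qed.

(** Block [t] acts exactly at the times [n * M + t], where the Fejer gap dominates the single term
    [l] with its positive weight. *)
Lemma DR_residual_cvg0 (t : 'I_M) (l : 'I_(gamma t)) :
  `|x (n * M + t)%N - T t l (x (n * M + t)%N)| @[n --> \oo] --> (0 : R).
Proof.
have [z /bigcap_common_fixed Fz] := C_meet.
have := fejer_gap_cvg0 (fun k => block_iteration_fejer k Fz).
move=> /(cvg_comp _ _ (@cvg_mulnD t)).
apply: (@cvg0_of_sqr_le _ (w t l)) => // n /=.
rewrite x_rec; have -> : Ordinal (ltn_pmod (n * M + t) M_gt0) = t.
  by apply: val_inj; rewrite /= modnMDl modn_small.
set u := x (n * M + t)%N.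
have := block_DR_fejer C_closed C_convex C0 (w_gt0 t) (w_sum1 t) u (Fz t).
rewrite (bigD1 l) //=.
have : 0 <= \sum_(j < gamma t | j != l) w t j * `|u - T t j u| ^+ 2.
  by apply: sumr_ge0 => j _; rewrite mulr_ge0 ?sqr_ge0 ?ltW.
by lra.
Qed.

(** Moves all residuals to the common times [n * M]: by nonexpansiveness the shift costs at most
    twice the distance travelled within the sweep. *)
Lemma sweep_residual_cvg0 (t : 'I_M) (l : 'I_(gamma t)) :
  `|x (n * M)%N - T t l (x (n * M)%N)| @[n --> \oo] --> (0 : R).
Proof.
have s := sweep_dist_cvg0 t.
apply: (cvg0_le (cvg0D (cvg0D s s) (@DR_residual_cvg0 t l))) => n.
rewrite normr_ge0 /=; set u := x (n * M)%N; set v := x (n * M + t)%N.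
have := DR_C_nonexpansive (idx t l) (idx t (ordS l)) v u.
have := ler_distD v u (T t l u); have := ler_distD (T t l v) v (T t l u).
by rewrite (distrC v u); lra.
Qed.

Lemma sweep_fejer n z : common_fixed z ->
  `|x (n.+1 * M)%N - z| <= `|x (n * M)%N - z|.
Proof.
(* Only the [M] counting the steps of the last sweep is generalized, not the one in [n * M]. *)
move=> Fz; rewrite mulSn addnC; move: {2}M => j.
elim: j => [|j IH]; first by rewrite addn0.
by rewrite addnS (le_trans (block_iteration_fejer _ Fz)).
Qed.

Lemma sweep_bounded : exists B : R, forall n, `|x (n * M)%N| <= B.
Proof.
have [z /bigcap_common_fixed Fz] := C_meet; exists (`|x 0%N - z| + `|z|) => n.
rewrite -[X in `|X|](subrK z) (le_trans (ler_normD _ _)) // lerD2r.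
elim: n => [|n IH]; first by rewrite mul0n.
by rewrite (le_trans (sweep_fejer n Fz)).
Qed.

Lemma sweep_ultra_fixed U c : UltraFilter U -> \oo `<=` U ->
  weakly_cvg_along U (fun n => x (n * M)%N) c -> common_fixed c.
Proof.
move=> Uu Uoo yc t l; have [B yB] := sweep_bounded.
apply: (demiclosed yB Uu _ yc).
- exact: DR_C_nonexpansive.
- by move=> A /(@sweep_residual_cvg0 t l) /Uoo.
Qed.

Lemma sweep_weakly_cvg :
  exists2 c, common_fixed c & weakly_cvg_to (fun n => x (n * M)%N) c.
Proof.
have [B yB] := sweep_bounded.
apply: (opial_weakly_cvg yB).
- by move=> u Fu; apply: fejer_dist_cvg => n; exact: sweep_fejer.
- exact: sweep_ultra_fixed.
Qed.

Lemma common_fixed_proj c (t : 'I_M) (l j : 'I_(gamma t)) : common_fixed c ->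
  C (idx t j) (metric_proj (C (idx t l)) c).
Proof.
by move=> Fc; apply: (@cyclic_DR_fixed _ _ _ (fun l => C (idx t l))) => // k;
  exact: Fc.
Qed.

Lemma common_fixed_interior c z (t : 'I_M) (l : 'I_(gamma t)) :
  interior (\bigcap_(i in [set: 'I_m]) C i) z -> common_fixed c ->
  C (idx t l) c.
Proof.
move=> Cz Fc; have <- : metric_proj (C (idx t l)) c = c.
  apply: (@DR_fixed_interior _ _ _ (C (idx t (ordS l))) _ _ _ _ _ _ c z) => //.
  by apply: (@filterS _ (nbhs z) _ _ _ _ Cz) => a Ca; split; exact: Ca.
exact: metric_proj_in.
Qed.

(** The limit exists because the set of common fixed points has an interior point; vanishing
    residuals and nonexpansiveness make the limit a common fixed point. *)
Lemma sweep_strongly_cvg z : interior (\bigcap_(i in [set: 'I_m]) C i) z ->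
  exists2 c, common_fixed c & x (n * M)%N @[n --> \oo] --> c.
Proof.
move=> Cz; set c := lim (x (n * M)%N @[n --> \oo]).
have yc : x (n * M)%N @[n --> \oo] --> c.
  apply: (fejer_interior_cvg (F := common_fixed) (z := z)).
    by move=> n u; exact: sweep_fejer.
  apply: (@filterS _ (nbhs z) _ _ _ _ Cz) => a.
  exact: bigcap_common_fixed.
exists c => // t l; apply/esym/eqP; rewrite -subr_eq0 -normr_le0.
have yc0 : `|c - x (n * M)%N| @[n --> \oo] --> (0 : R).
  rewrite -[X in _ --> X](normr0 H) -(subrr c); apply: cvg_norm.
  by apply: cvgB => //; exact: cvg_cst.
(* A constant sequence, squeezed to 0 by the residuals and twice the distance to the limit. *)
pose f (n : nat) := `|c - T t l c|.
suff f0 : f n @[n --> \oo] --> (0 : R).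
  have fc : f n @[n --> \oo] --> `|c - T t l c| by exact: cvg_cst.
  by rewrite (cvg_unique _ fc f0).
apply: (cvg0_le (cvg0D (cvg0D yc0 yc0) (@sweep_residual_cvg0 t l))) => n.
rewrite /f normr_ge0 /=; set u := x (n * M)%N.
have := DR_C_nonexpansive (idx t l) (idx t (ordS l)) u c.
have := ler_distD u c (T t l c); have := ler_distD (T t l u) u (T t l c).
by rewrite (distrC u c); lra.
Qed.

End block_iteration.

Theorem theorem19 (R : realType) (H : hilbertType R)
  (m : nat) (C : 'I_m -> set H)
  (C_closed : forall i, closed (C i))
  (C_convex : forall i, convex_set (C i))
  (C_meet : \bigcap_(i in [set: 'I_m]) C i !=set0)
  (M : nat) (M_gt0 : (0 < M)%N)
  (gamma : 'I_M -> nat) (gamma_gt0 : forall t, (0 < gamma t)%N)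
  (idx : forall t : 'I_M, 'I_(gamma t) -> 'I_m)
  (idx_inj : forall t, injective (idx t))
  (idx_cover : forall i : 'I_m, exists t : 'I_M, exists l, idx t l = i)
  (w : forall t : 'I_M, 'I_(gamma t) -> R)
  (w_gt0 : forall t l, 0 < w t l)
  (w_sum1 : forall t, \sum_(l < gamma t) w t l = 1)
  (Q := fun t : 'I_M => block_DR C (idx t) (w t))
  (x : nat -> H)
  (x_rec : forall k, x k.+1 = Q (Ordinal (ltn_pmod k M_gt0)) (x k))
  (y := fun k : nat => x (k * M)%N) :
  (exists ystar : H, weakly_cvg_to y ystar /\
     forall (t : 'I_M) (l : 'I_(gamma t)),
       (\bigcap_(j in [set: 'I_(gamma t)]) C (idx t j))
         (metric_proj (C (idx t l)) ystar)) /\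
  (interior (\bigcap_(i in [set: 'I_m]) C i) !=set0 ->
   exists ystar : H, y k @[k --> \oo] --> ystar /\
     (\bigcap_(i in [set: 'I_m]) C i) ystar).
Proof.
have [c Fc yc] := sweep_weakly_cvg C_closed C_convex C_meet w_gt0 w_sum1 x_rec.
split.
  exists c; split=> // t l j _.
  exact: (common_fixed_proj C_closed C_convex C_meet _ _ Fc).
move=> [z Cz].
have [d Fd yd] := sweep_strongly_cvg C_closed C_convex C_meet w_gt0 w_sum1
  x_rec Cz.
exists d; split=> // i _; have [t [l <-]] := idx_cover i.
exact: (common_fixed_interior C_closed C_convex C_meet l Cz Fd).
Qed.
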